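(* For every integer $k\ge 3$ there exist real constants $A_k,B_k,C_k,D_k,E_k,F_k,G_k$ such that the polynomial identity $$P^{(1)}_k(x)=(A_kx^3+B_kx^2+C_kx+D_k)\,P^{(1)}_{k-3}(x)+(E_kx^2+F_kx+G_k)\,P^{(1)}_{k-2}(x)$$ holds.
   Context: Let $(c_i)_{i\ge 0}$ be a sequence of real numbers and let $c$ be the linear functional on the space of real polynomials in one variable defined by $c(x^i)=c_i$ for $i\ge 0$. (In the application to the Lanczos method for $A\mathbf{x}=\mathbf{b}$ one has $c_i=(\mathbf{y},A^i\mathbf{r}_0)$.) Let $c^{(1)}$ be the linear functional defined by $c^{(1)}(x^i)=c(x^{i+1})=c_{i+1}$. Standing assumptions: for every $n\ge 1$ the Hankel determinant $H^{(1)}_n=\det(c_{i+j+1})_{0\le i,j\le n-1}$ is nonzero. Consequently, for every $n\ge 0$ there is a unique polynomial $P_n$ of degree at most $n$ with $P_n(0)=1$ and $c(x^iP_n)=0$ for $0\le i\le n-1$, and a unique monic polynomial $P^{(1)}_n$ of degree $n$ with $c^{(1)}(x^iP^{(1)}_n)=0$ for $0\le i\le n-1$ (so $P_0=P_0^{(1)}=1$). Moreover $\{P_n\}$ is an orthogonal polynomial sequence with respect to $c$, meaning that for every $n\ge 0$ the polynomial $P_n$ has degree exactly $n$ and $c(x^nP_n)\ne 0$. *)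

(* Defs.v *)
From HB Require Import structures.
From mathcomp Require Import all_boot all_order all_algebra.
From mathcomp Require Import reals.

Set Implicit Arguments.
Unset Strict Implicit.
Unset Printing Implicit Defensive.

Import Order.TTheory GRing.Theory Num.Theory.
Local Open Scope ring_scope.

Section MomentFunctional.
Context {R : realType}.
Implicit Types (c : nat -> R) (p : {poly R}).

(* The linear functional with moments c; see moment_functionalXn and the
   linear instance below. *)
Definition moment_functional c p : R := \sum_(i < size p) p`_i * c i.

Lemma moment_functionalE c p n : (size p <= n)%N ->
  moment_functional c p = \sum_(i < n) p`_i * c i.
Proof.
move=> le_pn; rewrite /moment_functional.
rewrite (big_ord_widen n (fun i => p`_i * c i) le_pn) big_mkcond /=.
apply: eq_bigr => i _; case: ltnP => // le_pi.
by rewrite nth_default ?mul0r.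
Qed.

Lemma moment_functional_is_scalar c : scalar (moment_functional c).
Proof.
move=> a p q; pose n := maxn (size p) (size q).
have le_pn : (size p <= n)%N by rewrite leq_maxl.
have le_qn : (size q <= n)%N by rewrite leq_maxr.
have le_sn : (size (a *: p + q)%R <= n)%N.
  apply: leq_trans (size_polyD _ _) _; rewrite geq_max le_qn andbT.
  exact: leq_trans (size_scale_leq _ _) le_pn.
rewrite (moment_functionalE c le_pn) (moment_functionalE c le_qn).
rewrite (moment_functionalE c le_sn) mulr_sumr -big_split /=.
by apply: eq_bigr => i _; rewrite coefD coefZ mulrDl mulrA.
Qed.

HB.instance Definition _ c :=
  GRing.isLinear.Build R {poly R} R *%R (moment_functional c)
    (moment_functional_is_scalar c).

Lemma moment_functionalXn c n : moment_functional c 'X^n = c n.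
Proof.
rewrite /moment_functional size_polyXn big_ord_recr /= coefXn eqxx mul1r.
rewrite big1 ?add0r // => i _.
by rewrite coefXn ltn_eqF ?mul0r.
Qed.

Definition shift_moments c : nat -> R := fun i => c i.+1.

Definition functional1 c : {poly R} -> R := moment_functional (shift_moments c).

Definition hankel1 c n : 'M[R]_n := \matrix_(i < n, j < n) c (i + j + 1)%N.

Definition is_P c n p : Prop :=
  [/\ (size p <= n.+1)%N, p.[0] = 1 &
      forall i, (i < n)%N -> moment_functional c ('X^i * p) = 0].

Definition is_P1 c n p : Prop :=
  [/\ p \is monic, size p = n.+1 &
      forall i, (i < n)%N -> functional1 c ('X^i * p) = 0].

Definition is_OPS c (P : nat -> {poly R}) : Prop :=
  forall n, size (P n) = n.+1 /\ moment_functional c ('X^n * P n) <> 0.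

End MomentFunctional.

(* Main.v *)
(* The monic polynomials orthogonal with respect to the shifted functional obey
   a three-term recurrence; eliminating the polynomial of index k-1 between two
   consecutive instances gives the relation, with A = B = 0. Nonsingularity of
   the Hankel matrices says that a polynomial of degree < n annihilating
   1, ..., x^(n-1) is zero; this gives both the nonvanishing norms that
   determine the recurrence coefficients and the recurrence itself. *)
From HB Require Import structures.
Require Import Defs.
From mathcomp Require Import all_boot all_order all_algebra.
From mathcomp Require Import reals.
From mathcomp Require Import ring.

Set Implicit Arguments.
Unset Strict Implicit.
Unset Printing Implicit Defensive.

Import Order.TTheory GRing.Theory Num.Theory.
Local Open Scope ring_scope.

HB.instance Definition _ (R : realType) (c : nat -> R) :=
  GRing.Linear.copy (functional1 c) (moment_functional (shift_moments c)).

(** The right-hand side is row [i] of [hankel1 c n] applied to the coefficient vector of [p], padded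
    with zeros up to [n]. *)
Lemma functional1_mulXn (R : realType) (c : nat -> R) n i (p : {poly R}) :
  (size p <= n)%N ->
  functional1 c ('X^i * p) = \sum_(j < n) p`_j * c (i + j + 1)%N.
Proof.
move=> le_pn; rewrite -{1}(coefK p) poly_def mulr_sumr linear_sum /=.
rewrite -(big_mkord xpredT (fun j => functional1 c ('X^i * (p`_j *: 'X^j)))).
rewrite -(big_mkord xpredT (fun j => p`_j * c (i + j + 1)%N)).
rewrite [RHS](big_cat_nat (leq0n _) le_pn) //= [X in _ = _ + X]big_nat_cond.
rewrite [X in _ = _ + X]big1 ?addr0 => [|j]; last first.
  by rewrite andbT => /andP[le_pj _]; rewrite nth_default ?mul0r.
apply: eq_bigr => j _; rewrite -scalerAr -exprD linearZ /=.
by rewrite /functional1 moment_functionalXn /shift_moments addn1.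
Qed.

Lemma functional1_eq0 (R : realType) (c : nat -> R) n (p : {poly R}) :
  \det (hankel1 c n) != 0 -> (size p <= n)%N ->
  (forall i, (i < n)%N -> functional1 c ('X^i * p) = 0) -> p = 0.
Proof.
move=> detH le_pn p_orth.
have /colP p0 : \col_(j < n) p`_j = 0.
  rewrite -[LHS](@mulKmx _ _ _ (hankel1 c n)) ?unitmxE ?unitfE //.
  suff -> : hankel1 c n *m (\col_(j < n) p`_j) = 0 by rewrite mulmx0.
  apply/colP => i; rewrite !mxE -[RHS](p_orth i) //.
  rewrite (functional1_mulXn _ _ le_pn).
  by apply: eq_bigr => j _; rewrite !mxE mulrC.
apply/polyP => j; rewrite coef0.
case: (ltnP j n) => [lt_jn|le_nj]; last by rewrite nth_default ?(leq_trans le_pn).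
by have := p0 (Ordinal lt_jn); rewrite !mxE.
Qed.

(** Otherwise [p], of size [n.+1], would annihilate all of [1, ..., 'X^n] and vanish, although it is
    monic. *)
Lemma functional1_norm_neq0 (R : realType) (c : nat -> R) n (p : {poly R}) :
  \det (hankel1 c n.+1) != 0 -> is_P1 c n p -> functional1 c ('X^n * p) != 0.
Proof.
move=> detH [p_monic sz_p p_orth]; apply: contra (monic_neq0 p_monic) => /eqP h0.
apply/eqP/(functional1_eq0 detH); first by rewrite sz_p.
by move=> i; rewrite ltnS leq_eqVlt => /predU1P[->|/p_orth].
Qed.

Lemma is_P1_three_term (R : realType) (c : nat -> R) n (p q r : {poly R}) :
  (forall m, (0 < m)%N -> \det (hankel1 c m) != 0) ->
  is_P1 c n p -> is_P1 c n.+1 q -> is_P1 c n.+2 r ->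
  exists a b, r = ('X - a%:P) * q - b *: p.
Proof.
move=> detH Pp Pq Pr; have hp := functional1_norm_neq0 (detH n.+1 isT) Pp.
have hq := functional1_norm_neq0 (detH n.+2 isT) Pq.
have [[_ sp po] [qM sq qo] [rM sr ro]] := And3 Pp Pq Pr.
pose L := functional1 c.
(* Testing the recurrence against ['X^n] forces [b]; testing it against ['X^(n.+1)] then forces
   [a]. *)
pose b := L ('X^(n.+1) * q) / L ('X^n * p).
pose a := (L ('X^(n.+2) * q) - b * L ('X^(n.+1) * p)) / L ('X^(n.+1) * q).
exists a, b; apply/eqP; rewrite -subr_eq0; apply/eqP.
set d := r - _.
have Ld i : L ('X^i * d) =
    L ('X^i * r) - L ('X^(i.+1) * q) + a * L ('X^i * q) + b * L ('X^i * p).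
  have -> : 'X^i * d = 'X^i * r - 'X^(i.+1) * q + a *: ('X^i * q) + b *: ('X^i * p).
    by rewrite /d -!mul_polyC exprS; ring.
  by rewrite /L !linearD linearN !linearZ.
apply: (functional1_eq0 (detH n.+2 isT)).
(* The leading terms of the monic [r] and ['X * q] cancel, so [d] has size at most [n.+2]. *)
- have -> : d = (r - 'X * q) + (a *: q + b *: p).
    by rewrite /d -!mul_polyC; ring.
  apply: leq_trans (size_polyD _ _) _; rewrite geq_max; apply/andP; split.
    apply/leq_sizeP => j; rewrite leq_eqVlt coefB => /predU1P[<-|lt_j].
      have -> : r`_n.+2 = 1 by have /monicP := rM; rewrite /lead_coef sr.
      rewrite coefXM /=.
      have -> : q`_n.+1 = 1 by have /monicP := qM; rewrite /lead_coef sq.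
      by rewrite subrr.
    by rewrite coefXM gtn_eqF ?(leq_trans _ lt_j)// !nth_default ?subrr ?sq ?sr//;
       case: j lt_j.
  apply: leq_trans (size_polyD _ _) _; rewrite geq_max.
  rewrite (leq_trans (size_scale_leq _ _)) ?sq //=.
  by rewrite (leq_trans (size_scale_leq _ _)) ?sp.
move=> i lt_i; rewrite -/L Ld {1}/L ro // sub0r.
(* For [i = n.+1] the choice of [a] gives zero, for [i = n] that of [b]; for [i < n] every term
   vanishes by orthogonality. *)
move: lt_i; rewrite ltnS leq_eqVlt => /predU1P[->|].
  by rewrite /a divfK //; ring.
rewrite ltnS leq_eqVlt => /predU1P[->|lt_in].
  by rewrite {2}/L qo // /b divfK //; ring.
by rewrite /L !qo ?po ?ltnS ?(ltnW lt_in) // !mulr0 oppr0 !addr0.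
Qed.

Theorem proposition3p5 (R : realType) (c : nat -> R) (P P1 : nat -> {poly R})
    (hH : forall n : nat, (1 <= n)%N -> \det (hankel1 c n) <> 0)
    (hP : forall n : nat, is_P c n (P n))
    (hP1 : forall n : nat, is_P1 c n (P1 n))
    (hOPS : is_OPS c P) :
  forall k : nat, (3 <= k)%N ->
  exists A B C D E F G : R,
    P1 k = (A *: 'X^3 + B *: 'X^2 + C *: 'X + D%:P) * P1 (k - 3)%N
         + (E *: 'X^2 + F *: 'X + G%:P) * P1 (k - 2)%N.
Proof.
move=> [|[|[|n]]] // _; rewrite !subSS subn0.
have detH m : (0 < m)%N -> \det (hankel1 c m) != 0 by move=> /hH/eqP.
have [a [b ->]] := is_P1_three_term detH (hP1 n.+1) (hP1 n.+2) (hP1 n.+3).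
have [a' [b' ->]] := is_P1_three_term detH (hP1 n) (hP1 n.+1) (hP1 n.+2).
(* Substitution gives the factors [('X - a)('X - a') - b] for [P1 n.+1] and [- b' ('X - a)] for
   [P1 n]; the witnesses are their coefficients. *)
exists 0, 0, (- b'), (a * b'), 1, (- (a + a')), (a * a' - b).
by rewrite -!mul_polyC !(rmorphN, rmorphB, rmorphD, rmorphM, rmorph0, rmorph1) /=; ring.
Qed.
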